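(* Let $\Gamma$ be a Coxeter diagram of rank $n=|V(\Gamma)|$ with associated Coxeter group $W_\Gamma$, and let $\mathrm{cc}_2(W_\Gamma)$ be the number of conjugacy classes of involutions in $W_\Gamma$. (1) There is only one conjugacy class of involutions in $W_\Gamma$, i.e. $\mathrm{cc}_2(W_\Gamma)=1$, if and only if the Coxeter diagram $\Gamma$ is complete (any two distinct vertices are joined by an edge), the odd graph $\Gamma^1$ is connected, and every edge label in $\Gamma$ is odd or $\infty$. (2) Every involution in $W_\Gamma$ is a reflection if and only if the diagram $\Gamma$ is complete and every edge label in $\Gamma$ is odd or $\infty$, in which case $\mathrm{cc}_2(W_\Gamma)=|\pi_0(\Gamma^1)|\le n$.
   Context: A Coxeter system $(W,S)$ of finite rank has $S=\{s_i\mid i\in I\}$, $I$ finite, and $W=\langle S\mid (s_is_j)^{m_{i,j}}\ (i,j\in I,\ m_{i,j}<\infty)\rangle$, with $m_{i,i}=1$ and $m_{i,j}=m_{j,i}\in\{2,3,\dots\}\cup\{\infty\}$ for $i\neq j$. Its Coxeter diagram $\Gamma$ has vertex set $V(\Gamma)=S$ and an edge $\{s_i,s_j\}$ iff $m_{i,j}\ge 3$, labeled by $m_{i,j}$ when $m_{i,j}\geq 4$ and unlabeled when $m_{i,j}=3$ (an unlabeled edge counts as having the odd label $3$); one writes $W=W_\Gamma$. The odd graph $\Gamma^1$ has vertex set $S$ (identified with the rank-one standard parabolic subgroups $\langle s\rangle$) and an edge $\{s_i,s_j\}$ iff $m_{i,j}$ is finite, odd and $\ge3$. $\pi_0$ denotes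 the set of connected components. An involution is an element of order exactly $2$. A reflection (with respect to $S$) is an element of the form $wsw^{-1}$ with $w\in W$, $s\in S$. *)

(* Defs.v *)
From HB Require Import structures.
From mathcomp Require Import all_boot generic_quotient.
From mathcomp Require Import boolp classical_sets cardinality.

Set Implicit Arguments.
Unset Strict Implicit.
Unset Printing Implicit Defensive.

Local Open Scope quotient_scope.
Local Open Scope group_scope.

(* The letter (x, true) stands for x and (x, false) for its formal inverse. *)
Section PresentedGroup.
Context (X : choiceType) (R : set (seq (X * bool))).
Notation word := (seq (X * bool)).

Definition inv_letter (a : X * bool) : X * bool := (a.1, ~~ a.2).
Definition inv_word (w : word) : word := rev [seq inv_letter a | a <- w].

(* Equality in <X | R>: the least equivalence on words that allows inserting
   or deleting a factor a a^-1 or a relator anywhere in a word. *)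
Inductive word_eq : word -> word -> Prop :=
| word_eq_refl w : word_eq w w
| word_eq_sym v w : word_eq v w -> word_eq w v
| word_eq_trans u v w : word_eq u v -> word_eq v w -> word_eq u w
| word_eq_cancel u v a : word_eq (u ++ [:: a; inv_letter a] ++ v) (u ++ v)
| word_eq_relator u v r : R r -> word_eq (u ++ r ++ v) (u ++ v).

Lemma inv_letterK : involutive inv_letter.
Proof. by case=> x b; rewrite /inv_letter /= negbK. Qed.

Lemma word_eq_catl u v w : word_eq v w -> word_eq (u ++ v) (u ++ w).
Proof.
elim=> {v w} [w|v w _|a b c _ + _|v w a|v w r Rr].
- exact: word_eq_refl.
- exact: word_eq_sym.
- exact: word_eq_trans.
- by rewrite !(catA u); apply: word_eq_cancel.
- by rewrite !(catA u); apply: word_eq_relator.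
Qed.

Lemma word_eq_catr u v w : word_eq v w -> word_eq (v ++ u) (w ++ u).
Proof.
elim=> {v w} [w|v w _|a b c _ + _|v w a|v w r Rr].
- exact: word_eq_refl.
- exact: word_eq_sym.
- exact: word_eq_trans.
- by rewrite -!catA; apply: word_eq_cancel.
- by rewrite -!catA; apply: word_eq_relator.
Qed.

Lemma word_eq_cat v v' w w' :
  word_eq v v' -> word_eq w w' -> word_eq (v ++ w) (v' ++ w').
Proof.
by move=> h1 h2; apply: word_eq_trans (word_eq_catr _ h1) (word_eq_catl _ h2).
Qed.

Lemma inv_word_cons a w : inv_word (a :: w) = inv_word w ++ [:: inv_letter a].
Proof. by rewrite /inv_word /= rev_cons cats1. Qed.

Lemma inv_wordK : involutive inv_word.
Proof.
by move=> w; rewrite /inv_word map_rev revK -map_comp map_id_in // => a _ /=;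
  rewrite inv_letterK.
Qed.

Lemma word_eq_mulV w : word_eq (w ++ inv_word w) [::].
Proof.
elim: w => [|a w IHw]; first exact: word_eq_refl.
rewrite inv_word_cons.
have := word_eq_catr [:: inv_letter a] (word_eq_catl [:: a] IHw).
rewrite -!catA => /word_eq_trans; apply.
exact: (word_eq_cancel [::] [::] a).
Qed.

Lemma word_eq_Vmul w : word_eq (inv_word w ++ w) [::].
Proof. by have := word_eq_mulV (inv_word w); rewrite inv_wordK. Qed.

Lemma word_eq_inv v w : word_eq v w -> word_eq (inv_word v) (inv_word w).
Proof.
move=> vw.
have h1 := word_eq_catr (inv_word w) (word_eq_Vmul v).
have h2 := word_eq_catl (inv_word v)
  (word_eq_trans (word_eq_catr (inv_word w) vw) (word_eq_mulV w)).
rewrite cats0 catA in h2.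
exact: word_eq_trans (word_eq_sym h2) h1.
Qed.

Definition word_eqb (v w : word) : bool := `[< word_eq v w >].

Lemma word_eqb_refl : reflexive word_eqb.
Proof. by move=> w; apply/asboolP; apply: word_eq_refl. Qed.

Lemma word_eqb_sym : symmetric word_eqb.
Proof. by move=> v w; apply/asboolP/asboolP; apply: word_eq_sym. Qed.

Lemma word_eqb_trans : transitive word_eqb.
Proof.
by move=> v u w /asboolP uv /asboolP vw; apply/asboolP/(word_eq_trans uv vw).
Qed.

Canonical word_equiv :=
  EquivRel word_eqb word_eqb_refl word_eqb_sym word_eqb_trans.

Definition presented_group : Type := {eq_quot word_equiv}.
HB.instance Definition _ := Choice.on presented_group.

Definition pg_class (w : word) : presented_group :=
  \pi_({eq_quot word_equiv}) w.
Definition pg_repr (g : presented_group) : word := repr (g : {eq_quot word_equiv}).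

Lemma pg_reprK g : pg_class (pg_repr g) = g.
Proof. exact: reprK. Qed.

Lemma pg_classP v w : pg_class v = pg_class w <-> word_eq v w.
Proof.
split=> [/(@eqmodP _ word_equiv)|vw]; first by move/asboolP.
by apply/(@eqmodP _ word_equiv)/asboolP.
Qed.

Lemma pg_repr_class w : word_eq (pg_repr (pg_class w)) w.
Proof. by apply/pg_classP; rewrite pg_reprK. Qed.

Definition pg_mul (g h : presented_group) := pg_class (pg_repr g ++ pg_repr h).
Definition pg_one := pg_class [::].
Definition pg_inv (g : presented_group) := pg_class (inv_word (pg_repr g)).

Lemma pg_class_cat v w : pg_class (v ++ w) = pg_mul (pg_class v) (pg_class w).
Proof.
by apply/pg_classP/word_eq_cat; apply: word_eq_sym; apply: pg_repr_class.
Qed.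

Lemma pg_class_inv w : pg_class (inv_word w) = pg_inv (pg_class w).
Proof. by apply/pg_classP/word_eq_inv/word_eq_sym/pg_repr_class. Qed.

Lemma pg_mulA : associative pg_mul.
Proof.
move=> x y z; rewrite -[x]pg_reprK -[y]pg_reprK -[z]pg_reprK.
by rewrite -!pg_class_cat catA.
Qed.

Lemma pg_mul1 : left_id pg_one pg_mul.
Proof. by move=> x; rewrite -[x]pg_reprK -pg_class_cat. Qed.

Lemma pg_mulr1 : right_id pg_one pg_mul.
Proof. by move=> x; rewrite -[x]pg_reprK -pg_class_cat cats0. Qed.

Lemma pg_mulV : left_inverse pg_one pg_inv pg_mul.
Proof.
move=> x; rewrite -[x]pg_reprK -pg_class_inv -pg_class_cat.
exact/pg_classP/word_eq_Vmul.
Qed.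

Lemma pg_mulrV : right_inverse pg_one pg_inv pg_mul.
Proof.
move=> x; rewrite -[x]pg_reprK -pg_class_inv -pg_class_cat.
exact/pg_classP/word_eq_mulV.
Qed.

HB.instance Definition _ := isGroup.Build presented_group
  pg_mulA pg_mul1 pg_mulr1 pg_mulV pg_mulrV.

Definition pg_gen (x : X) : presented_group := pg_class [:: (x, true)].

End PresentedGroup.

(* [None] encodes m_{i,j} = infinity. *)
Record coxeter_matrix (I : finType) := CoxeterMatrix {
  cox_m :> I -> I -> option nat;
  cox_diag : forall i, cox_m i i = Some 1%N;
  cox_sym : forall i j, cox_m i j = cox_m j i;
  cox_ge2 : forall i j k, i != j -> cox_m i j = Some k -> (2 <= k)%N }.

Section Coxeter.
Context (I : finType) (M : coxeter_matrix I).

(* The word (s_i s_j)^k. *)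
Definition braid_word (i j : I) (k : nat) : seq (I * bool) :=
  flatten (nseq k [:: (i, true); (j, true)]).

Definition coxeter_relators : set (seq (I * bool)) :=
  [set r | exists i j k, M i j = Some k /\ r = braid_word i j k]%classic.

Definition coxeter_group : Type := presented_group coxeter_relators.
HB.instance Definition _ := Group.on coxeter_group.

Definition cox_gen (i : I) : coxeter_group := pg_gen coxeter_relators i.

Definition is_reflection (g : coxeter_group) : Prop :=
  exists w i, g = w * cox_gen i * w^-1.

(* The Coxeter diagram has vertex set I, its edge {i, j} being labelled by
   m_{i,j} (including m_{i,j} = 3); loops are excluded since m_{i,i} = 1. *)
Definition diagram_edge (i j : I) : bool :=
  if M i j is Some k then (3 <= k)%N else true.

Definition diagram_complete : Prop := forall i j, i != j -> diagram_edge i j.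

Definition labels_odd_or_infinite : Prop :=
  forall i j, diagram_edge i j -> if M i j is Some k then odd k else true.

Definition odd_edge (i j : I) : bool :=
  if M i j is Some k then odd k && (3 <= k)%N else false.

(* n_comp counts connected components only for a symmetric edge relation. *)
Lemma odd_edge_connect_sym : connect_sym odd_edge.
Proof. by apply: sym_connect_sym => i j; rewrite /odd_edge cox_sym. Qed.

Definition odd_components : nat := n_comp odd_edge I.

(* The empty graph has no component, hence is not connected. *)
Definition odd_graph_connected : Prop := odd_components = 1%N.

End Coxeter.

Section Involutions.
Context (G : groupType).

Definition is_involution (g : G) : Prop := g != 1 /\ g ^+ 2 = 1.

Definition conj_class (g : G) : set G :=
  [set h | exists w, h = w * g * w^-1]%classic.

Definition involution_classes : set (set G) :=
  [set C | exists2 g, is_involution g & C = conj_class g]%classic.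

(* cc_2(G) = k; in particular G has finitely many classes of involutions. *)
Definition cc2_eq (k : nat) : Prop := (involution_classes #= `I_k)%card.

End Involutions.

(* Main.v *)
From HB Require Import structures.
Require Import Defs.
From mathcomp Require Import all_boot all_order all_algebra.
From mathcomp Require Import boolp classical_sets functions cardinality.
From mathcomp Require Import Rstruct reals trigo.
From mathcomp Require Import zify lra ring.

(* Conjugate an involution g to one of minimal length, and let D be its set of
   descents.  In the geometric representation with gram i j = 2 cos(pi / m_ij),
   minimality forces g to negate the simple roots of D.  If D contained two
   generators with m_ij infinite, or three generators pairwise joined in the
   diagram, the sum of their roots would pair nonpositively with every simple
   root, hence could only grow under W, and could not be negated.  If
   D = {i, j} with m_ij odd, the longest word of <s_i, s_j> times g maps every
   simple root to a nonnegative vector, so it is 1, yet it exchanges the roots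
   of i and j.  Hence D = {i}, and then s_i g = 1 for the same reason.
   Conversely, for m_ij even (s_i s_j)^(m_ij/2) is an involution of even length,
   whereas reflections have odd length; and the number mod 2 of letters from a
   component of the odd graph separates the classes of generators. *)

Set Implicit Arguments.
Unset Strict Implicit.
Unset Printing Implicit Defensive.

(** * Words, lengths and parities *)

Section CoxeterWords.
Context (I : finType) (M : coxeter_matrix I).
Local Open Scope group_scope.
Local Notation G := (coxeter_group M).
Local Notation s := (cox_gen M).

Definition cox_word (w : seq I) : G :=
  pg_class (coxeter_relators M) [seq (i, true) | i <- w].

Lemma cox_word_nil : cox_word [::] = 1.
Proof. by []. Qed.

Lemma cox_word_cat v w : cox_word (v ++ w) = cox_word v * cox_word w.
Proof. by rewrite /cox_word map_cat; apply: pg_class_cat. Qed.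

Lemma cox_word_cons i w : cox_word (i :: w) = s i * cox_word w.
Proof. by rewrite -cat1s cox_word_cat. Qed.

Lemma cox_word_rcons w i : cox_word (rcons w i) = cox_word w * s i.
Proof. by rewrite -cats1 cox_word_cat. Qed.

Lemma cox_relation i j k : M i j = Some k -> (s i * s j) ^+ k = 1.
Proof.
move=> mij; suff <- : pg_class (coxeter_relators M) (braid_word i j k) =
  (s i * s j) ^+ k.
  apply/pg_classP.
  have := @word_eq_relator _ (coxeter_relators M) [::] [::] (braid_word i j k).
  by rewrite cats0; apply; exists i, j, k.
elim: k {mij} => [|k IHk]; first by rewrite expg0.
rewrite expgS -IHk /braid_word /= -(cat1s (i, true)) -(cat1s (j, true)).
by rewrite !pg_class_cat; apply: mulgA.
Qed.

Lemma cox_gen_sq i : s i * s i = 1.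
Proof. by have := cox_relation (cox_diag M i); rewrite expg1. Qed.

Lemma cox_genV i : (s i)^-1 = s i.
Proof. exact/mulg1_eq/cox_gen_sq. Qed.

Lemma cox_genK (g : G) i : g * s i * s i = g.
Proof. by rewrite -mulgA cox_gen_sq mulg1. Qed.

Lemma cox_wordV w : (cox_word w)^-1 = cox_word (rev w).
Proof.
elim: w => [|i w IHw]; first by rewrite /= !cox_word_nil invg1.
by rewrite rev_cons cox_word_rcons cox_word_cons invgM IHw cox_genV.
Qed.

Lemma cox_word_surj (g : G) : exists w, cox_word w = g.
Proof.
rewrite -(pg_reprK g); elim: (pg_repr g) => [|[i b] w [v IHw]].
  by exists [::].
exists (i :: v); rewrite cox_word_cons IHw -(cat1s (i, b)) pg_class_cat.
apply: (congr1 (fun h : G => h * _)); case: b => //.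
by rewrite -[LHS]cox_genV; symmetry; apply: (pg_class_inv _ [:: (i, true)]).
Qed.

(* Every letter is an involution of W, so a letter and its formal inverse act
   alike. *)
Section Action.
Context (T : Type) (f : I -> T -> T).
Hypothesis f_inv : forall i, involutive (f i).
Hypothesis f_rel : forall i j k x, i != j -> M i j = Some k ->
  iter k (f i \o f j) x = x.

Local Notation act_letters := (foldr (fun a : I * bool => f a.1)).

Lemma act_word_eq u v : word_eq (coxeter_relators M) u v ->
  forall x, act_letters x u = act_letters x v.
Proof.
elim=> {u v} [//|v w _ IH x|u v w _ IHu _ IHv x|u v [i b] x|u v r].
- by rewrite IH.
- by rewrite IHu IHv.
- by rewrite !foldr_cat /= f_inv.
case=> i [j] [k] [mij ->] x; rewrite !foldr_cat; congr (foldr _ _ _).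
set y := foldr _ _ v.
have -> : act_letters y (braid_word i j k) = iter k (f i \o f j) y.
  elim: k {mij} => [//|k IHk].
  by rewrite /braid_word /= -/(braid_word i j k) IHk.
have [eij|nij] := eqVneq i j; last exact: f_rel.
by move: mij; rewrite -eij cox_diag => -[<-] /=; rewrite f_inv.
Qed.

Definition cox_act (g : G) (x : T) : T := act_letters x (pg_repr g).

Lemma cox_act_word w x : cox_act (cox_word w) x = foldr f x w.
Proof.
rewrite /cox_act (act_word_eq (@pg_repr_class _ _ _)).
by elim: w => //= i w ->.
Qed.

Lemma cox_actM (g h : G) x : cox_act (g * h) x = cox_act g (cox_act h x).
Proof.
have [v <-] := cox_word_surj g; have [w <-] := cox_word_surj h.
by rewrite -cox_word_cat !cox_act_word foldr_cat.
Qed.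

End Action.

(** * Parity homomorphisms *)

Section Sign.
Context (C : pred I).
Hypothesis C_odd : forall i j, odd_edge M i j -> C i = C j.

Let flip (i : I) (b : bool) := b (+) C i.

Let flip_inv i : involutive (flip i).
Proof. by move=> b; rewrite /flip addbK. Qed.

(** For even k every letter toggles an even number of times; for odd k the letters i and j are
    joined in the odd graph, so [C] agrees on them and the toggles cancel. *)
Let flip_rel i j k b : i != j -> M i j = Some k ->
  iter k (flip i \o flip j) b = b.
Proof.
move=> nij mij.
have -> : iter k (flip i \o flip j) b = b (+) (odd k && (C i (+) C j)).
  elim: k {mij} => [|k IHk] /=; first by rewrite addbF.
  by rewrite IHk {IHk} /flip /=; case: b (odd k) (C i) (C j) => [] [] [] [].
case ok: (odd k); last by rewrite addbF.
rewrite (C_odd (j := j)) ?addbb ?addbF // /odd_edge mij ok /=.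
by have := cox_ge2 nij mij; case: k ok {mij} => [|[|[]]].
Qed.

Definition cox_parity (g : G) : bool := cox_act flip g false.

Lemma cox_parity_word w : cox_parity (cox_word w) = odd (count C w).
Proof.
rewrite /cox_parity cox_act_word; [|exact: flip_inv|exact: flip_rel].
by elim: w => //= i w ->; rewrite /flip oddD addbC; case: (C i).
Qed.

Lemma cox_parity_gen i : cox_parity (s i) = C i.
Proof. by rewrite (cox_parity_word [:: i]) /= addn0; case: (C i). Qed.

Lemma cox_parityM (g h : G) :
  cox_parity (g * h) = cox_parity g (+) cox_parity h.
Proof.
have [v <-] := cox_word_surj g; have [w <-] := cox_word_surj h.
by rewrite -cox_word_cat !cox_parity_word count_cat oddD.
Qed.

Lemma cox_parityV (g : G) : cox_parity g^-1 = cox_parity g.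
Proof.
by have [w <-] := cox_word_surj g; rewrite cox_wordV !cox_parity_word count_rev.
Qed.

Lemma cox_parityJ (g h : G) : cox_parity (g * h * g^-1) = cox_parity h.
Proof. by rewrite !cox_parityM cox_parityV addbAC addbb. Qed.

End Sign.

Lemma cox_gen_involution i : is_involution (s i).
Proof.
split; last by rewrite expg2 cox_gen_sq.
apply/negP => /eqP si1.
(* With [C] everywhere true, the number of letters mod 2 separates [s i] from 1. *)
have := @cox_parity_gen predT (fun _ _ _ => erefl) i.
by rewrite si1 -cox_word_nil cox_parity_word.
Qed.

(** * Word length and alternating words *)

Definition has_word (g : G) n := `[< exists2 w, size w = n & cox_word w = g >].

Lemma ex_has_word (g : G) : exists n, has_word g n.
Proof.
by have [w gw] := cox_word_surj g; exists (size w); apply/asboolP; exists w.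
Qed.

Definition cox_length (g : G) := ex_minn (ex_has_word g).
Local Notation l := cox_length.

Lemma cox_length_word w : l (cox_word w) <= size w.
Proof.
rewrite /cox_length; case: ex_minnP => n _; apply.
by apply/asboolP; exists w.
Qed.

Lemma reduced_word (g : G) : exists2 w, size w = l g & cox_word w = g.
Proof. by rewrite /cox_length; case: ex_minnP => n /asboolP. Qed.

Lemma cox_length_cat (g : G) w : l (g * cox_word w) <= l g + size w.
Proof.
have [v <- <-] := reduced_word g.
by rewrite -cox_word_cat -size_cat cox_length_word.
Qed.

Lemma cox_length_gen (g : G) i : l (g * s i) <= (l g).+1.
Proof. by rewrite -addn1; apply: (cox_length_cat g [:: i]). Qed.

Lemma cox_length_gen_ge (g : G) i : l g <= (l (g * s i)).+1.
Proof. by rewrite -{1}(cox_genK g i) cox_length_gen. Qed.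

Lemma cox_lengthV (g : G) : l g^-1 = l g.
Proof.
suff le h : l h^-1 <= l h by apply/eqP; rewrite eqn_leq le -{1}(invgK g) le.
have [w <- <-] := reduced_word h.
by rewrite cox_wordV -size_rev cox_length_word.
Qed.

Lemma cox_length_descent (g : G) : g <> 1 -> exists i, l (g * s i) < l g.
Proof.
have [w] := reduced_word g; case/lastP: w => [_ <- //|w i sz gw _]; exists i.
by rewrite -{1}gw cox_word_rcons cox_genK -sz size_rcons ltnS cox_length_word.
Qed.

(* The last letter is j, whatever the length. *)
Fixpoint alt_word (i j : I) (k : nat) : seq I :=
  if k is k'.+1 then rcons (alt_word j i k') j else [::].

Lemma size_alt_word i j k : size (alt_word i j k) = k.
Proof. by elim: k i j => //= k IHk i j; rewrite size_rcons IHk. Qed.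

Lemma alt_wordSl i j k :
  alt_word i j k.+1 = (if odd k then i else j) :: alt_word i j k.
Proof.
elim: k i j => // k IHk i j.
by rewrite -[LHS]/(rcons (alt_word j i k.+1) j) IHk /=; case: (odd k).
Qed.

Lemma mem_alt_word i j k : {subset alt_word i j k <= pred2 i j}.
Proof.
elim: k i j => //= k IHk i j x; rewrite mem_rcons inE => /orP[/eqP->|/IHk].
  by rewrite !inE eqxx orbT.
by rewrite !inE orbC.
Qed.

(** Fixing the last letter makes every shorter alternating word a suffix of the longer ones. *)
Lemma alt_wordD i j m n : exists2 u, size u = n &
  alt_word i j (n + m) = u ++ alt_word i j m.
Proof.
elim: n => [|n [u szu IHn]]; first by exists [::].
by rewrite addSn alt_wordSl IHn; eexists (_ :: u); rewrite /= ?szu.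
Qed.

Lemma cox_word_alt_double i j k :
  cox_word (alt_word i j k.*2) = (s i * s j) ^+ k.
Proof.
elim: k => [|k IHk]; first by rewrite expg0.
by rewrite doubleS /= !cox_word_rcons IHk expgSr mulgA.
Qed.

Lemma alt_word_braid i j m : M i j = Some m ->
  cox_word (alt_word i j m) = cox_word (alt_word j i m).
Proof.
move=> mij; have mji : M j i = Some m by rewrite cox_sym.
(* Each peeled letter becomes one more factor of the power while k + n stays constant: n = 0 is the
   goal, k = 0 the Coxeter relation. *)
suff alt k n i' j' : (s i' * s j') ^+ (k + n) = 1 ->
    (s j' * s i') ^+ (k + n) = 1 ->
    cox_word (alt_word i' j' k) * (s i' * s j') ^+ n =
      cox_word (alt_word j' i' k).
  have := alt m 0 i j; rewrite addn0 expg0 mulg1.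
  by apply; apply: cox_relation.
elim: k n i' j' => [|k IHk] n i' j' r1 r2; first by rewrite r1 mulg1.
rewrite /= !cox_word_rcons -(IHk n.+1 j' i') ?addnS // expgSr !mulgA.
rewrite cox_genK -!mulgA; congr (_ * _).
elim: n {r1 r2} => [|n IHn]; first by rewrite expg0 mulg1 mul1g.
by rewrite !expgS -!mulgA IHn !mulgA.
Qed.

End CoxeterWords.

(** * Chebyshev recursion *)

Section Chebyshev.
Import Order.TTheory GRing.Theory Num.Theory.
Local Open Scope ring_scope.
Context (R : realType).

Fixpoint cheb_rec (c a b : R) (n : nat) : R :=
  if n is n'.+1 then cheb_rec c b (c * b - a) n' else a.

Lemma cheb_recSS c a b n :
  cheb_rec c a b n.+2 = c * cheb_rec c a b n.+1 - cheb_rec c a b n.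
Proof. by elim: n a b => [//|n IHn] a b; apply: IHn. Qed.

(** The Chebyshev polynomial of the second kind with shifted index, U_(n-1)(c / 2). *)
Definition cheb c n := cheb_rec c 0 1 n.

Lemma cheb0 c : cheb c 0 = 0. Proof. by []. Qed.
Lemma cheb1 c : cheb c 1 = 1. Proof. by []. Qed.
Lemma chebSS c n : cheb c n.+2 = c * cheb c n.+1 - cheb c n.
Proof. exact: cheb_recSS. Qed.

(** The recursion is linear, so its solutions are combinations of [cheb] and its shift; the
    induction carries two consecutive values. *)
Lemma cheb_recE c a b n :
  cheb_rec c a b n.+1 = b * cheb c n.+1 - a * cheb c n.
Proof.
suff: cheb_rec c a b n.+1 = b * cheb c n.+1 - a * cheb c n /\
      cheb_rec c a b n.+2 = b * cheb c n.+2 - a * cheb c n.+1 by case.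
elim: n => [|n [IH1 IH2]]; first by split; rewrite /cheb /=; ring.
by split=> //; rewrite cheb_recSS IH1 IH2 (chebSS _ n.+1) (chebSS _ n); ring.
Qed.

#[global] Arguments cheb_rec : simpl never.

Lemma cheb2 n : cheb 2 n = n%:R.
Proof.
suff: cheb 2 n = n%:R /\ cheb 2 n.+1 = n.+1%:R by case.
elim: n => [|n [IH1 IH2]]; first by rewrite cheb0 cheb1.
by split=> //; rewrite chebSS IH1 IH2 -!natr1; ring.
Qed.

Lemma cheb_cos x n : sin x * cheb (2 * cos x) n = sin (n%:R * x).
Proof.
suff: sin x * cheb (2 * cos x) n = sin (n%:R * x) /\
      sin x * cheb (2 * cos x) n.+1 = sin (n.+1%:R * x) by case.
elim: n => [|n [IH1 IH2]].
  by rewrite cheb0 cheb1 mul0r sin0 mulr0 mulr1 mul1r.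
split=> //; rewrite chebSS mulrBr IH1 mulrCA IH2.
have -> : n.+2%:R * x = n.+1%:R * x + x by rewrite -(natr1 n.+1); ring.
have -> : n%:R * x = n.+1%:R * x - x by rewrite -(natr1 n); ring.
by rewrite !sinD sinN cosN; ring.
Qed.

Definition cheb_root (m : nat) : R := 2 * cos (pi / m%:R).

Section Root.
Context (m : nat) (m2 : (2 <= m)%N).
Local Notation c := (cheb_root m).

Let m_gt0 : 0 < m%:R :> R. Proof. by rewrite ltr0n; case: m m2. Qed.

Let angle_bounds : 0 < (pi : R) / m%:R < pi.
Proof.
rewrite divr_gt0 ?pi_gt0 //= ltr_pdivrMr // ltr_pMr ?pi_gt0 //.
by rewrite (ltr_nat _ 1).
Qed.

Let sin_angle_gt0 : 0 < sin (pi / m%:R) :> R.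
Proof. exact: sin_gt0_pi. Qed.

Let chebE n : cheb c n = sin (n%:R * (pi / m%:R)) / sin (pi / m%:R).
Proof. by rewrite -cheb_cos mulrC mulKf ?gt_eqF. Qed.

Let mul_angle : m%:R * (pi / m%:R) = pi :> R.
Proof. by rewrite mulrC divfK ?gt_eqF. Qed.

(** The angle n pi / m does not exceed pi, so its sine is nonnegative. *)
Lemma cheb_root_ge0 n : (n <= m)%N -> 0 <= cheb c n.
Proof.
move=> nm; rewrite chebE divr_ge0 ?(ltW sin_angle_gt0) // sin_ge0_pi //.
have [/ltW a0 _] := andP angle_bounds.
by rewrite mulr_ge0 //= -[X in _ <= X]mul_angle ler_wpM2r // ler_nat.
Qed.

Lemma cheb_root_eq0 : cheb c m = 0.
Proof. by rewrite chebE mul_angle sinpi mul0r. Qed.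

Lemma cheb_rootS : cheb c m.+1 = -1.
Proof.
rewrite chebE -natr1 mulrDl mul_angle mul1r addrC sinDpi.
by rewrite mulNr divff ?gt_eqF.
Qed.

Lemma cheb_root_double : cheb c m.*2 = 0.
Proof.
by rewrite chebE -muln2 natrM mulrAC mul_angle mulr_natr sin2pi mul0r.
Qed.

Lemma cheb_root_doubleS : cheb c m.*2.+1 = 1.
Proof.
rewrite chebE -natr1 -muln2 natrM mulrDl mulrAC mul_angle mulr_natr mul1r.
by rewrite addrC sinD2pi divff ?gt_eqF.
Qed.

Lemma cheb_root_nonneg : 0 <= c.
Proof. by have := cheb_root_ge0 m2; rewrite chebSS cheb1 cheb0; lra. Qed.

(** Strictness makes the rank two linear system in [simple_refl_rel] nonsingular. *)
Lemma cheb_root_sq_lt4 : c ^+ 2 < 4.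
Proof.
have s0 : 0 < sin (pi / m%:R) ^+ 2 :> R by rewrite exprn_gt0.
by move: s0; rewrite sin2cos2 /cheb_root; lra.
Qed.

Lemma cheb_root_ge1 : (3 <= m)%N -> 1 <= c.
Proof.
move=> m3; have c0 := cheb_root_nonneg.
(* [cheb c 3] is c ^ 2 - 1. *)
by have := cheb_root_ge0 m3; rewrite !chebSS cheb1 cheb0; nra.
Qed.

End Root.
End Chebyshev.

(** * The geometric representation *)

Section GeometricRepresentation.
Import Order.TTheory GRing.Theory Num.Theory.
Local Open Scope ring_scope.
Context (R : realType) (I : finType) (M : coxeter_matrix I).
Local Notation G := (coxeter_group M).
Local Notation V := {ffun I -> R}.
Local Notation s := (cox_gen M).
Local Notation l := (@cox_length I M).

(* Minus twice the Tits form, so that off-diagonal entries are nonnegative. *)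
Definition gram (i j : I) : R :=
  if M i j is Some m then cheb_root R m else 2.

(** The minus sign undoes that of [gram]: a simple root pairs to 2 with its own index, so
    [simple_refl] is the usual reflection. *)
Definition pairing (v : V) (i : I) : R := \sum_j v j * - gram j i.

Definition simple_root (i : I) : V := [ffun j => (j == i)%:R].

Definition root_comb (i j : I) (a b : R) : V :=
  [ffun k => (k == i)%:R * a + (k == j)%:R * b].

Definition simple_refl (i : I) (v : V) : V :=
  [ffun j => v j - (j == i)%:R * pairing v i].

Lemma gram_sym i j : gram i j = gram j i.
Proof. by rewrite /gram cox_sym. Qed.

Lemma gram_diag i : gram i i = -2.
Proof. by rewrite /gram cox_diag /cheb_root divr1 cospi; ring. Qed.

Lemma gram_ge0 i j : i != j -> 0 <= gram i j.
Proof.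
rewrite /gram => nij; case mij: (M i j) => [m|] //.
exact: cheb_root_nonneg (cox_ge2 nij mij).
Qed.

Lemma gram_ge1 i j : diagram_edge M i j -> 1 <= gram i j.
Proof.
rewrite /diagram_edge /gram; case: (M i j) => [m m3|_]; last by lra.
by rewrite cheb_root_ge1 // ltnW.
Qed.

Lemma cheb_gram_ge0 i j n : i != j ->
  (if M i j is Some m then n <= m else true)%N -> 0 <= cheb (gram i j) n.
Proof.
rewrite /gram => nij; case mij: (M i j) => [m|] nm.
  exact: cheb_root_ge0 (cox_ge2 nij mij) _ nm.
by rewrite cheb2 ler0n.
Qed.

Lemma sum_delta (F : I -> R) i : \sum_j (j == i)%:R * F j = F i.
Proof.
rewrite (bigD1 i) //= eqxx mul1r big1 ?addr0 // => j /negPf ->.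
by rewrite mul0r.
Qed.

Lemma pairing_simple_root i j : pairing (simple_root i) j = - gram i j.
Proof.
rewrite /pairing -[RHS](sum_delta (fun k => - gram k j) i).
by apply: eq_bigr => k _; rewrite ffunE.
Qed.

Lemma pairing_comb i j a b k :
  pairing (root_comb i j a b) k = - (a * gram i k + b * gram j k).
Proof.
transitivity (\sum_h (h == i)%:R * (- (a * gram h k)) +
              \sum_h (h == j)%:R * (- (b * gram h k))).
  by rewrite -big_split; apply: eq_bigr => h _; rewrite ffunE /=; ring.
by rewrite !sum_delta; ring.
Qed.

Lemma pairing_refl i v j :
  pairing (simple_refl i v) j = pairing v j + pairing v i * gram i j.
Proof.
transitivity (pairing v j + \sum_h (h == i)%:R * (pairing v i * gram h j)).
  by rewrite -big_split; apply: eq_bigr => h _; rewrite ffunE /=; ring.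
by rewrite sum_delta.
Qed.

Lemma simple_refl_inv i : involutive (simple_refl i).
Proof.
move=> v; apply/ffunP => j; rewrite !ffunE pairing_refl gram_diag; ring.
Qed.

(* The pairings of v with i and j evolve by a linear recursion whose period
   divides 2m, and a vector of the plane spanned by the two simple roots is
   determined by these pairings because gram i j ^+ 2 != 4. *)
Lemma simple_refl_rel i j m (v : V) : i != j -> M i j = Some m ->
  iter m (simple_refl i \o simple_refl j) v = v.
Proof.
move=> nij mij; have m2 := cox_ge2 nij mij.
have gE : gram i j = cheb_root R m by rewrite /gram mij.
pose c := gram i j; pose p := pairing v i; pose q := pairing v j.
pose rho n := iter n (simple_refl i \o simple_refl j) v.
(* Up to sign, the two pairings occupy consecutive places of one sequence; applying s_i s_j advances
   it by two places. *)
have pair_rho n : pairing (rho n) i = - cheb_rec c (- p) q n.*2 /\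
                  pairing (rho n) j = cheb_rec c (- p) q n.*2.+1.
  elim: n => [|n [IHi IHj]]; first by rewrite /= opprK.
  rewrite /rho iterS -/(rho n) doubleS /=.
  rewrite !pairing_refl !gram_diag (gram_sym j i) IHi IHj -/c.
  by rewrite !cheb_recSS; split; ring.
have out n k : k != i -> k != j -> rho n k = v k.
  move=> ki kj; elim: n => [//|n IHn].
  by rewrite /rho iterS -/(rho n) /= !ffunE (negPf ki) (negPf kj) IHn /=; ring.
have per1 : cheb_rec c (- p) q m.*2.+1 = q.
  by rewrite cheb_recE /c gE cheb_root_double ?cheb_root_doubleS //; ring.
have per2 : cheb_rec c (- p) q m.*2.+2 = c * q + p.
  rewrite cheb_recE /c gE chebSS cheb_root_double ?cheb_root_doubleS //; ring.
have per0 : cheb_rec c (- p) q m.*2 = - p.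
  by move: per2; rewrite cheb_recSS per1 => e; lra.
have [pi_m pj_m] := pair_rho m; rewrite per0 per1 in pi_m pj_m.
have pairD k : pairing (rho m) k = pairing v k -
    ((rho m i - v i) * gram i k + (rho m j - v j) * gram j k).
  rewrite -pairing_comb -big_split; apply: eq_bigr => h _ /=.
  rewrite !ffunE -mulrDl; congr (_ * _).
  have [->|hi] := eqVneq h i; first by rewrite (negPf nij) /=; ring.
  have [->|hj] := eqVneq h j; first by rewrite /=; ring.
  by rewrite (out m h) //=; ring.
have := pairD i; have := pairD j.
rewrite pi_m pj_m -/p -/q !gram_diag (gram_sym j i) -/c.
set x := rho m i - v i; set y := rho m j - v j => ej ei.
have c4 : c ^+ 2 < 4 by rewrite /c gE cheb_root_sq_lt4.
(* The equations [ei] and [ej] amount to c y = 2 x and c x = 2 y; eliminating y leaves the factor 4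
   - c ^ 2. *)
have x0 : x = 0.
  have e : (4 - c ^+ 2) * x = 0 by rewrite expr2; nra.
  by move/eqP: e; rewrite mulf_eq0 => /orP[/eqP|/eqP] //; lra.
have y0 : y = 0 by rewrite x0 in ei ej; lra.
apply/ffunP => k; rewrite -/(rho m).
have [->|ki] := eqVneq k i; first by apply/eqP; rewrite -subr_eq0 -/x x0.
have [->|kj] := eqVneq k j; first by apply/eqP; rewrite -subr_eq0 -/y y0.
exact: out.
Qed.

Definition geo (g : G) : V -> V := cox_act simple_refl g.

Lemma geo_word w v : geo (cox_word M w) v = foldr simple_refl v w.
Proof.
exact: (cox_act_word simple_refl_inv (fun i j m v => @simple_refl_rel i j m v)).
Qed.

Lemma geo1 v : geo 1%g v = v.
Proof. by rewrite -(cox_word_nil M) geo_word. Qed.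

Lemma geo_gen i v : geo (s i) v = simple_refl i v.
Proof. exact: (geo_word [:: i]). Qed.

Lemma geoM (g h : G) v : geo (g * h)%g v = geo g (geo h v).
Proof.
exact: (cox_actM simple_refl_inv (fun i j m v => @simple_refl_rel i j m v)).
Qed.

(** The action is built from plain functions, so its linearity is proved by induction on a word. *)
Lemma geo_expand g v k : geo g v k = \sum_j v j * geo g (simple_root j) k.
Proof.
have [w <-] := cox_word_surj g.
under eq_bigr do rewrite geo_word.
rewrite geo_word; elim: w k => [|i w IHw] k /=.
  rewrite -[LHS](sum_delta v); apply: eq_bigr => j _.
  by rewrite ffunE eq_sym mulrC.
under eq_bigr do rewrite ffunE mulrBr mulrCA.
rewrite ffunE sumrB -IHw -mulr_sumr; congr (_ - _ * _).
rewrite /pairing; under eq_bigr do rewrite IHw mulr_suml.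
rewrite exchange_big; apply: eq_bigr => j _ /=.
by rewrite mulr_sumr; apply: eq_bigr => h _; rewrite mulrA.
Qed.

Lemma geo_lin g a (u : V) b (v : V) :
  geo g [ffun k => a * u k + b * v k] =
  [ffun k => a * geo g u k + b * geo g v k].
Proof.
apply/ffunP => k; rewrite geo_expand ffunE (geo_expand g u) (geo_expand g v).
by rewrite !mulr_sumr -big_split; apply: eq_bigr => j _; rewrite ffunE /=; ring.
Qed.


Lemma geo_opp (g : G) (v : V) :
  geo g [ffun k => - v k] = [ffun k => - geo g v k].
Proof.
have -> : [ffun k => - v k] = [ffun k => -1 * v k + 0 * v k].
  by apply/ffunP => k; rewrite !ffunE; ring.
by rewrite geo_lin; apply/ffunP => k; rewrite !ffunE; ring.
Qed.

Lemma geo_comb g i j a b k :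
  geo g (root_comb i j a b) k =
  a * geo g (simple_root i) k + b * geo g (simple_root j) k.
Proof.
have -> : root_comb i j a b =
    [ffun h => a * simple_root i h + b * simple_root j h].
  by apply/ffunP => h; rewrite !ffunE; ring.
by rewrite geo_lin ffunE.
Qed.

Lemma geoK (g : G) : cancel (geo g) (geo g^-1%g).
Proof. by move=> v; rewrite -geoM mulVg geo1. Qed.

Lemma simple_refl_root i :
  simple_refl i (simple_root i) = [ffun k => - simple_root i k].
Proof.
by apply/ffunP => k; rewrite !ffunE pairing_simple_root gram_diag; ring.
Qed.

Lemma simple_refl_comb i j a b : i != j ->
  simple_refl j (root_comb i j a b) = root_comb j i (gram i j * a - b) a.
Proof.
move=> nij; apply/ffunP => k.
by rewrite !ffunE pairing_comb gram_diag; ring.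
Qed.

Lemma root_comb10 i j : root_comb i j 1 0 = simple_root i.
Proof. by apply/ffunP => k; rewrite !ffunE; ring. Qed.

(** By the Chebyshev recursion, the reflection in j raises both indices by one and exchanges the
    roles of i and j; a general n lets the induction absorb this. *)
Lemma geo_alt i j n k : i != j ->
  geo (cox_word M (alt_word i j k))
    (root_comb i j (cheb (gram i j) n.+1) (cheb (gram i j) n)) =
  (if odd k then root_comb j i else root_comb i j)
    (cheb (gram i j) (n + k).+1) (cheb (gram i j) (n + k)).
Proof.
elim: k i j n => [|k IHk] i j n nij; first by rewrite addn0 geo1.
rewrite /= cox_word_rcons geoM geo_gen simple_refl_comb // -chebSS.
by rewrite gram_sym IHk 1?eq_sym // addSnnS; case: (odd k).
Qed.

Lemma geo_alt_root i j k : i != j ->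
  geo (cox_word M (alt_word i j k)) (simple_root i) =
  (if odd k then root_comb j i else root_comb i j)
    (cheb (gram i j) k.+1) (cheb (gram i j) k).
Proof. by move=> nij; rewrite -(geo_alt 0) // cheb0 cheb1 root_comb10. Qed.

(* Strip from w the longest alternating suffix in the letters i, j: what is
   left has neither i nor j as a descent, and the suffix has fewer than m_ij
   letters, so it maps the root of i to a nonnegative combination of the roots
   of i and j. *)
Lemma geo_root_ge0 (w : G) i : (l w <= l (w * s i)%g)%N ->
  forall k, 0 <= geo w (simple_root i) k.
Proof.
have [n] := ubnP (l w); elim: n w i => // n IHn w i lwn lwi k.
have [->|/eqP w1] := eqVneq w 1%g; first by rewrite geo1 ffunE ler0n.
have [j lwj] := cox_length_descent w1.
have nij : i != j by apply/eqP => eij; rewrite -eij in lwj; lia.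
suff strip v p : (0 < p)%N -> w = (v * cox_word M (alt_word i j p))%g ->
    (l v + p = l w)%N -> 0 <= geo w (simple_root i) k.
  apply: (strip (w * s j)%g 1%N) => //; first by rewrite /= cox_genK.
  by have := cox_length_gen_ge w j; lia.
have [q] := ubnP (l v); elim: q v p => // q IHq v p lvq p_gt0 wE lE.
pose r b := if b then i else j.
(* [r (odd p)] is the letter that would prolong the alternating suffix to the left. *)
have [lt_r|le_r] := ltnP (l (v * s (r (odd p)))%g) (l v).
  apply: (IHq (v * s (r (odd p)))%g p.+1) => //; first by lia.
    by rewrite wE alt_wordSl cox_word_cons mulgA cox_genK.
  by have := cox_length_gen_ge v (r (odd p)); lia.
(* The other letter is the first one of the suffix; if it were a descent of v, then w would be
   shorter than l v + p. *)
have le_r' : (l v <= l (v * s (r (~~ odd p)))%g)%N.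
  case: p p_gt0 wE lE {le_r IHq} => // p _ wE lE.
  rewrite /= negbK leqNgt; apply/negP => lt_r.
  have := cox_length_cat (v * s (r (odd p)))%g (alt_word i j p).
  rewrite size_alt_word -mulgA -cox_word_cons.
  by rewrite -[_ :: _](alt_wordSl i j p) -wE; lia.
have vi : (l v <= l (v * s i)%g)%N by case: (odd p) le_r le_r'.
have vj : (l v <= l (v * s j)%g)%N by case: (odd p) le_r le_r'.
have lvn : (l v < n)%N by lia.
(* If p >= m, the braid relation makes the suffix end in i, and then [w * s i] is shorter than w. *)
have p_lt : is_true (if M i j is Some m then p < m else true)%N.
  case mij: (M i j) => [m|//]; rewrite ltnNge; apply/negP => lemp.
  have m2 := cox_ge2 nij mij.
  have [u szu altE] := alt_wordD i j m (p - m).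
  have wsE : (w * s i = v * cox_word M (u ++ alt_word i j m.-1))%g.
    rewrite wE -{1}(subnK lemp) altE !cox_word_cat -!mulgA.
    rewrite (alt_word_braid mij) -{1}(prednK (ltnW m2)) /= cox_word_rcons.
    by rewrite cox_genK.
  have := cox_length_cat v (u ++ alt_word i j m.-1).
  by rewrite -wsE size_cat size_alt_word szu; lia.
have cp : 0 <= cheb (gram i j) p.
  by apply: cheb_gram_ge0 => //; case: (M i j) p_lt => // m; apply: ltnW.
have cpS : 0 <= cheb (gram i j) p.+1 by apply: cheb_gram_ge0.
rewrite wE geoM geo_alt_root //.
by case: ifP => _; rewrite geo_comb addr_ge0 ?mulr_ge0 ?IHn.
Qed.

Lemma geo_root_le0 (w : G) i : (l (w * s i)%g < l w)%N ->
  forall k, geo w (simple_root i) k <= 0.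
Proof.
move=> lwi k; rewrite -(cox_genK w i) geoM geo_gen simple_refl_root geo_opp.
by rewrite ffunE oppr_le0 geo_root_ge0 // cox_genK ltnW.
Qed.

Lemma geo_root_neq0 (w : G) i : geo w (simple_root i) <> [ffun _ => 0].
Proof.
move=> e; have /ffunP/(_ i) := geoK w (simple_root i).
have -> : geo w (simple_root i) = [ffun k => - geo w (simple_root i) k].
  by rewrite e; apply/ffunP => k; rewrite !ffunE oppr0.
rewrite geo_opp geoK !ffunE eqxx /= => {}e; lra.
Qed.

(** A descent of w would send its simple root to a vector both nonnegative and nonpositive, hence to
    0, against invertibility. *)
Lemma geo_roots_ge0 (w : G) :
  (forall i k, 0 <= geo w (simple_root i) k) -> w = 1%g.
Proof.
move=> w_ge0; apply/eqP/negPn/negP => /eqP/cox_length_descent[i lwi].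
apply: (@geo_root_neq0 w i); apply/ffunP => k; rewrite ffunE.
by apply/le_anti; rewrite w_ge0 geo_root_le0.
Qed.

(** Induction on the length of w: for a descent i, the reflection adds a nonnegative multiple of the
    root of i to d, and [w * s i] keeps that root nonnegative. *)
Lemma geo_antidominant (w : G) (d : V) : (forall i, pairing d i <= 0) ->
  forall k, d k <= geo w d k.
Proof.
move=> d_le0; have [n] := ubnP (l w); elim: n w => // n IHn w lwn k.
have [->|/eqP w1] := eqVneq w 1%g; first by rewrite geo1.
have [i lwi] := cox_length_descent w1.
have geo_d : geo w d k = geo (w * s i)%g d k +
    - pairing d i * geo (w * s i)%g (simple_root i) k.
  rewrite -{1}(cox_genK w i) geoM geo_gen.
  have -> : simple_refl i d =
      [ffun h => 1 * d h + - pairing d i * simple_root i h].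
    by apply/ffunP => h; rewrite !ffunE; ring.
  by rewrite geo_lin ffunE mul1r.
rewrite geo_d (le_trans (IHn (w * s i)%g _ k)) ?(leq_trans lwi) //.
by rewrite lerDl mulr_ge0 ?oppr_ge0 // geo_root_ge0 // cox_genK ltnW.
Qed.

(** The image of the root under g is nonpositive, but becomes nonnegative after s_i, which alters
    coordinate i only. So the image is a multiple a of the root of i; g being its own inverse, a ^ 2
    = 1, and a <= 0. *)
Lemma geo_minimal_descent (g : G) i : (g * g = 1)%g ->
  (l g <= l (s i * g * s i)%g)%N -> (l (g * s i)%g < l g)%N ->
  geo g (simple_root i) = [ffun k => - simple_root i k].
Proof.
move=> gg gmin lgi.
have gV : (g^-1 = g)%g by apply/mulg1_eq.
have ge0 : forall k, 0 <= geo (s i * g)%g (simple_root i) k.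
  apply: geo_root_ge0; apply: leq_trans gmin.
  by rewrite -(cox_lengthV (s i * g)%g) invgM cox_genV gV ltnW.
have le0 := geo_root_le0 lgi.
pose a := geo g (simple_root i) i.
have gE : geo g (simple_root i) = root_comb i i a 0.
  apply/ffunP => k; rewrite ffunE mulr0 addr0.
  have [->|nki] := eqVneq k i; first by rewrite mul1r.
  rewrite mul0r; apply/le_anti; rewrite le0 /=.
  by have := ge0 k; rewrite geoM geo_gen ffunE (negPf nki) mul0r subr0.
have aa : a * a = 1.
  have /ffunP/(_ i) : geo g (geo g (simple_root i)) = simple_root i.
    by rewrite -geoM gg geo1.
  by rewrite {1}gE geo_comb mul0r addr0 ffunE eqxx.
have a1 : a = -1 by have := le0 i; rewrite -/a; nra.
by apply/ffunP => k; rewrite gE !ffunE a1; ring.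
Qed.

Lemma foldr_refl_out (v : V) w k : k \notin w ->
  foldr simple_refl v w k = v k.
Proof.
elim: w => //= i w IHw; rewrite inE negb_or => /andP[/negPf ki kw].
by rewrite ffunE ki mul0r subr0 IHw.
Qed.

(** All simple roots must stay nonnegative. If one outside J became nonpositive, its image under g
    would lie in the span of J, because w leaves the other coordinates alone; g negates that span,
    so applying g again would put the root itself in the span of J. *)
Lemma geo_cancel_prefix (J : pred I) (w : seq I) (g : G) :
  (g * g = 1)%g -> {subset w <= J} ->
  {in J, forall j, geo g (simple_root j) = [ffun k => - simple_root j k]} ->
  {in [predC J], forall j k, 0 <= geo g (simple_root j) k} ->
  {in J, forall j k, 0 <= geo (cox_word M w * g)%g (simple_root j) k} ->
  (cox_word M w * g = 1)%g.
Proof.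
move=> gg wJ gJ gJC wgJ; apply: geo_roots_ge0 => i.
have [iJ|iJ] := boolP (i \in J); first exact: wgJ.
case: (leqP (l (cox_word M w * g)%g) (l (cox_word M w * g * s i)%g)).
  exact: geo_root_ge0.
move/geo_root_le0 => le0.
have out k : k \notin J -> geo g (simple_root i) k = 0.
  move=> kJ; apply/le_anti; rewrite gJC // andbT; have := le0 k.
  by rewrite geoM geo_word foldr_refl_out //; apply: contra kJ; apply: wJ.
have /ffunP/(_ i) : geo g (geo g (simple_root i)) = simple_root i.
  by rewrite -geoM gg geo1.
rewrite geo_expand big1 => [|j _].
  by rewrite ffunE eqxx => /eqP; rewrite eq_sym oner_eq0.
have [jJ|jJ] := boolP (j \in J); last by rewrite out ?mul0r.
rewrite (gJ _ jJ) !ffunE.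
have [eij|_] := eqVneq i j; last by rewrite oppr0 mulr0.
by rewrite eij jJ in iJ.
Qed.

(* A vector that pairs nonpositively with every simple root can only grow
   under the action of W, so it cannot be negated. *)
Lemma geo_negated_set (A : {set I}) (g : G) i0 : i0 \in A ->
  {in A, forall j, geo g (simple_root j) = [ffun k => - simple_root j k]} ->
  {in A, forall i, 2 <= \sum_(j in A | j != i) gram j i} -> False.
Proof.
move=> i0A gA sumA; pose d : V := [ffun k => (k \in A)%:R].
have sum_in (F : I -> R) : \sum_j d j * F j = \sum_(j in A) F j.
  rewrite [RHS]big_mkcond; apply: eq_bigr => j _; rewrite ffunE.
  by case: ifP => _; rewrite ?mul1r ?mul0r.
have d_le0 i : pairing d i <= 0.
  rewrite /pairing sum_in sumrN oppr_le0.
  have [iA|iA] := boolP (i \in A).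
    by rewrite (bigD1 i) //= gram_diag; have := sumA i iA; lra.
  apply: sumr_ge0 => j jA; apply: gram_ge0.
  by apply: contraNneq iA => <-.
(* At coordinate [i0] the inequality becomes 1 <= -1. *)
have := geo_antidominant g d_le0 i0; rewrite geo_expand sum_in.
rewrite (eq_bigr (fun j => - (j == i0)%:R)) => [|j jA]; last first.
  by rewrite gA // !ffunE eq_sym.
rewrite sumrN (bigD1 i0) //= eqxx big1 => [|j /andP[_ /negPf->] //].
by rewrite ffunE i0A /=; lra.
Qed.

(** The coefficients at m + 1 and m are -1 and 0, and oddness of m exchanges the two roots. *)
Lemma geo_alt_longest i j m : i != j -> M i j = Some m -> odd m ->
  geo (cox_word M (alt_word i j m)) (simple_root i) =
  [ffun k => - simple_root j k].
Proof.
move=> nij mij om; have m2 := cox_ge2 nij mij.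
rewrite geo_alt_root // om /gram mij cheb_rootS // cheb_root_eq0 //.
by apply/ffunP => k; rewrite !ffunE; ring.
Qed.

(** * From minimal involutions to reflections *)

Lemma minimal_involution_generator (g : G) :
  diagram_complete M -> labels_odd_or_infinite M -> is_involution g ->
  (forall i, (l g <= l (s i * g * s i)%g)%N) -> exists i, g = s i.
Proof.
move=> Mcomp Modd [/eqP g1]; rewrite expg2 => gg gmin.
pose D i := (l (g * s i)%g < l g)%N.
have gD i : D i -> geo g (simple_root i) = [ffun k => - simple_root i k].
  by move=> Di; apply: geo_minimal_descent.
have gDC i : ~~ D i -> forall k, 0 <= geo g (simple_root i) k.
  by rewrite /D -leqNgt; apply: geo_root_ge0.
have [i Di] := cox_length_descent g1.
have [/existsP[j /andP[nji Dj]]|/existsPn onlyi] :=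
  boolP [exists j, (j != i) && D j]; last first.
  exists i; rewrite -(cox_genV M i); apply/esym/mulg1_eq.
  apply: (geo_cancel_prefix (J := pred1 i) (w := [:: i])) => //.
  - by move=> j; rewrite !inE.
  - by move=> j; rewrite inE => /eqP->; apply: gD.
  - by move=> j; rewrite !inE => nji; apply: gDC; have := onlyi j; rewrite nji.
  move=> j; rewrite inE => /eqP-> k.
  rewrite geoM gD // geo_opp geo_word /= simple_refl_root !ffunE opprK.
  exact: ler0n.
exfalso; have nij : i != j by rewrite eq_sym.
case mij: (M i j) => [m|]; last first.
  apply: (@geo_negated_set [set i; j] g i); first by rewrite !inE eqxx.
    by move=> k; rewrite !inE => /orP[]/eqP->; apply: gD.
  have g2 : gram i j = 2 by rewrite /gram mij.
  move=> k; rewrite !inE => /orP[]/eqP->.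
    rewrite (bigD1 j) /=; last by rewrite !inE eqxx orbT.
    rewrite gram_sym g2 big1 ?addr0 // => h; rewrite !inE.
    by case: eqP => //= _; case: eqP.
  rewrite (bigD1 i) /=; last by rewrite !inE eqxx.
  rewrite g2 big1 ?addr0 // => h; rewrite !inE.
  by case: eqP => //= _; case: eqP.
have om : odd m by have := Modd i j (Mcomp i j nij); rewrite mij.
have [/existsP[k /and3P[nki nkj Dk]]|/existsPn onlyij] :=
  boolP [exists k, [&& k != i, k != j & D k]].
  apply: (@geo_negated_set [set k; i; j] g i).
  - by rewrite !inE eqxx orbT.
  - by move=> h; rewrite !inE -orbA => /or3P[]/eqP->; apply: gD.
  move=> h hA.
  have cardA : #|[set k; i; j] :\ h| = 2%N.
    apply/eqP; rewrite -(eqn_add2l 1%N) -[X in (X + _)%N]/(nat_of_bool true).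
    rewrite -hA -cardsD1 -finset.setUA cardsU1 cards2 !inE.
    by rewrite negb_or nki nkj nij.
  (* Each of the two other members of the triple contributes at least 1, by completeness of the
     diagram. *)
  apply: (@le_trans _ _ (\sum_(h' in [set k; i; j] | h' != h) 1)).
    rewrite sumr_const -cardA ler_nat; apply: eq_leq; apply: eq_card => h'.
by rewrite [RHS]unfold_in !inE andbC.
  apply: ler_sum => h' /andP[_ nh]; apply: gram_ge1; exact: Mcomp.
(* Both factors negate the two roots and the longest word also swaps them, so the product just swaps
   them. *)
have longest j' : j' \in pred2 i j ->
    geo (cox_word M (alt_word i j m) * g)%g (simple_root j') =
    simple_root (if j' == i then j else i).
  move=> j'_ij; rewrite geoM gD; last by case/pred2P: j'_ij => ->.
  rewrite geo_opp; case/pred2P: j'_ij => ->; rewrite ?eqxx ?(negPf nji).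
    by rewrite geo_alt_longest //; apply/ffunP => k; rewrite !ffunE opprK.
  rewrite (alt_word_braid mij) geo_alt_longest // 1?cox_sym //.
  by apply/ffunP => k; rewrite !ffunE opprK.
have wg1 : (cox_word M (alt_word i j m) * g = 1)%g.
  apply: (geo_cancel_prefix (J := pred2 i j)) => //.
  - exact: mem_alt_word.
  - by move=> h /pred2P[]->; apply: gD.
  - move=> h; rewrite !inE negb_or => /andP[nhi nhj]; apply: gDC.
    by have := onlyij h; rewrite nhi nhj.
  by move=> h h_ij k; rewrite longest // ffunE ler0n.
have := longest i; rewrite wg1 geo1 !inE eqxx => /(_ isT)/ffunP/(_ i).
by rewrite !ffunE eqxx (negPf nij) => /eqP; rewrite oner_eq0.
Qed.

(** Conjugating by generators as long as this shortens g ends at a generator. *)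
Lemma involution_is_reflection (g : G) :
  diagram_complete M -> labels_odd_or_infinite M -> is_involution g ->
  is_reflection g.
Proof.
move=> Mcomp Modd; have [n] := ubnP (l g); elim: n g => // n IHn g lgn g_inv.
have [/existsP[i lt_i]|/existsPn gmin] :=
    boolP [exists i, l (s i * g * s i)%g < l g]%N; last first.
  have [i|i ->] := minimal_involution_generator Mcomp Modd g_inv.
    by rewrite leqNgt gmin.
  by exists 1%g, i; rewrite mul1g invg1 mulg1.
have gE : (g = s i * (s i * g * s i) * s i)%g.
  by rewrite !mulgA cox_gen_sq mul1g cox_genK.
have [||w [j wE]] := IHn (s i * g * s i)%g; first exact: leq_trans lt_i _.
  case: g_inv => g1 gg; split.
    by apply: contraNneq g1 => e; rewrite gE e mulg1 cox_gen_sq.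
  by rewrite expg2 !mulgA cox_genK -!mulgA (mulgA g) -expg2 gg mul1g cox_gen_sq.
by exists (s i * w)%g, j; rewrite gE wE invgM cox_genV !mulgA.
Qed.

(** The power is not 1 because it negates the root of i: as a word it has m = 2h letters, an even
    number. *)
Lemma dihedral_involution i j h : i != j -> M i j = Some h.*2 ->
  is_involution ((s i * s j) ^+ h)%g.
Proof.
move=> nij mij; split; last by rewrite -expgnA muln2 cox_relation.
apply/negP => /eqP e; have m2 := cox_ge2 nij mij.
have := geo_alt_root h.*2 nij; rewrite cox_word_alt_double e geo1.
rewrite odd_double /gram mij cheb_rootS // cheb_root_eq0 //.
by move/ffunP/(_ i); rewrite !ffunE eqxx (negPf nij) /= => {}e; clear -e; lra.
Qed.

End GeometricRepresentation.

(** * Classes of involutions *)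

Section Classes.
Context (I : finType) (M : coxeter_matrix I).
Local Open Scope group_scope.
Local Notation G := (coxeter_group M).
Local Notation s := (cox_gen M).

Lemma conj_classM (G' : groupType) (w g : G') :
  conj_class (w * g * w^-1) = conj_class g.
Proof.
apply/seteqP; split=> _ [v ->].
  by exists (v * w); rewrite invgM !mulgA.
by exists (v * w^-1); rewrite invgM invgK !mulgA !mulgVK.
Qed.

Lemma conj_class_refl (G' : groupType) (g : G') : conj_class g g.
Proof. by exists 1; rewrite mul1g invg1 mulg1. Qed.

(** With m = 2h + 1, conjugating s_i by (s_i s_j)^h gives s_i (s_j s_i)^(m-1), which is s_j by the
    Coxeter relation. *)
Lemma odd_edge_conj i j : odd_edge M i j ->
  conj_class (s i) = conj_class (s j).
Proof.
rewrite /odd_edge; case mij: (M i j) => [m|//] /andP[om _].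
suff <- : (s i * s j) ^+ m./2 * s i * ((s i * s j) ^+ m./2)^-1 = s j.
  by rewrite conj_classM.
have sisj n : (s i * s j) ^+ n * s i = s i * (s j * s i) ^+ n.
  elim: n => [|n IHn]; first by rewrite !expg0 mul1g mulg1.
  by rewrite !expgS -mulgA IHn !mulgA.
have invX n : ((s i * s j) ^+ n)^-1 = (s j * s i) ^+ n.
  elim: n => [|n IHn]; first by rewrite !expg0 invg1.
  by rewrite expgS expgSr invgM IHn invgM !cox_genV.
rewrite sisj invX -mulgA -expgnDr addnn.
have <- : m.-1 = m./2.*2 by rewrite -[in LHS](odd_double_half m) om.
apply: (mulIg (s j * s i)); rewrite -mulgA -expgSr prednK ?odd_gt0 //.
by rewrite cox_relation 1?cox_sym // mulg1 mulgA cox_gen_sq mul1g.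
Qed.

Lemma odd_connect_conj i j : connect (odd_edge M) i j <->
  conj_class (s i) = conj_class (s j).
Proof.
split=> [/connectP[p + ->]|e].
  by elim: p i => //= k p IHp i /andP[/odd_edge_conj -> /IHp].
(* Membership in the odd component of i is a valid [C], and its parity is constant on conjugacy
   classes. *)
have Codd k h : odd_edge M k h ->
    connect (odd_edge M) i k = connect (odd_edge M) i h.
  move=> kh; rewrite !(odd_edge_connect_sym M i).
  exact: (same_connect (odd_edge_connect_sym M) (connect1 kh)).
have := conj_class_refl (s j); rewrite -e => -[w sjE].
by rewrite -(cox_parity_gen Codd) sjE cox_parityJ // cox_parity_gen.
Qed.

Lemma reflections_cc2 :
  (forall g : G, is_involution g -> is_reflection g) ->
  cc2_eq G (odd_components M).
Proof.
(* One representative per odd component; [odd_components M] is by definition the cardinal of this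
   predicate. *)
move=> refl; pose rts := predI (roots (odd_edge M)) I.
pose f (x : 'I_#|rts|) := conj_class (s (enum_val x)).
have csym := odd_edge_connect_sym M.
have f_inj : injective f.
  move=> x y /odd_connect_conj; rewrite -(root_connect csym) => /eqP.
  have rt (z : 'I_#|rts|) :
      fingraph.root (odd_edge M) (enum_val z) = enum_val z.
    by have := enum_valP z; rewrite !inE => /andP[/eqP].
  by rewrite !rt => /enum_val_inj.
have fE : @involution_classes G = (f @` [set: 'I_#|rts|])%classic.
  apply/seteqP; split=> [C [g g_inv ->]|_ [x _ <-]].
    have [w [i ->]] := refl g g_inv; rewrite conj_classM.
    have ri : fingraph.root (odd_edge M) i \in rts by rewrite !inE roots_root.
    exists (enum_rank_in ri (fingraph.root (odd_edge M) i)) => //.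
    rewrite /f enum_rankK_in //; apply/odd_connect_conj.
    by rewrite csym connect_root.
  by exists (s (enum_val x)) => //; apply: cox_gen_involution.
rewrite /cc2_eq fE.
apply: card_eq_trans (inj_card_eq (in2W f_inj)) _.
by rewrite card_eq_sym card_II.
Qed.

(** This excludes m = 2 as well, whence completeness of the diagram. *)
Lemma all_reflections_labels i j m :
  (forall g : G, is_involution g -> is_reflection g) ->
  i != j -> M i j = Some m -> odd m.
Proof.
move=> refl nij mij; apply/negPn/negP => em.
have mE : m = m./2.*2 by rewrite -[LHS]odd_double_half (negPf em).
rewrite mE in mij.
have [w [k]] := refl _ (dihedral_involution Rdefinitions.R nij mij).
have Codd (h h' : I) : odd_edge M h h' -> predT h = predT h' by [].
move/(congr1 (cox_parity predT)); rewrite cox_parityJ // cox_parity_gen //.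
rewrite -cox_word_alt_double cox_parity_word // count_predT size_alt_word.
by rewrite odd_double.
Qed.

Lemma reflections_iff :
  (forall g : G, is_involution g -> is_reflection g) <->
  diagram_complete M /\ labels_odd_or_infinite M.
Proof.
split=> [refl|[Mcomp Modd] g]; last first.
  exact: (involution_is_reflection Rdefinitions.R).
split=> i j.
  rewrite /diagram_edge => nij; case mij: (M i j) => [m|//].
  have := all_reflections_labels refl nij mij; have := cox_ge2 nij mij.
  by case: m mij => [|[|[]]].
rewrite /diagram_edge; have [->|nij] := eqVneq i j; first by rewrite cox_diag.
by case mij: (M i j) => [m|//] _; apply: all_reflections_labels mij.
Qed.

Lemma cc2_1_reflections : cc2_eq G 1 ->
  forall g : G, is_involution g -> is_reflection g.
Proof.
move=> cc1 g g_inv.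
(* An involution is not the empty word, so at least one generator exists. *)
have [w [i _]] : exists w : seq I, exists i, i \in w.
  have [w gE] := cox_word_surj g; case: w gE => [gE|i w _]; last first.
    by exists (i :: w), i; rewrite inE eqxx.
  by case: g_inv => /eqP; rewrite -gE.
(* The classes inject into [I_1], whose only element is 0. *)
have same C C' : @involution_classes G C -> @involution_classes G C' -> C = C'.
  move=> CG C'G; have /card_eqPle[/pcard_leP[f] _] := cc1.
  apply: 'inj_f; rewrite ?inE //.
  have := 'funS_f CG; have := 'funS_f C'G => /=.
  by case: (f C) (f C') => [|?] [|?].
have e : conj_class (s i) = conj_class g.
  by apply: same; [exists (s i) => //; exact: cox_gen_involution | exists g].
by have := conj_class_refl g; rewrite -e => -[v ->]; exists v, i.
Qed.

End Classes.

Theorem corollary1p3 (I : finType) (M : coxeter_matrix I) :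
  (cc2_eq (coxeter_group M) 1 <->
     [/\ diagram_complete M, odd_graph_connected M &
         labels_odd_or_infinite M])
  /\
  ((forall g : coxeter_group M, is_involution g -> is_reflection g) <->
     diagram_complete M /\ labels_odd_or_infinite M)
  /\
  (diagram_complete M /\ labels_odd_or_infinite M ->
     cc2_eq (coxeter_group M) (odd_components M) /\
     odd_components M <= #|I|).
Proof.
split; [|split; first exact: reflections_iff].
  split=> [cc1|[Mcomp Mconn Modd]].
    have refl := cc2_1_reflections cc1.
    have [Mcomp Modd] := (reflections_iff M).1 refl.
    (* The set of classes has both 1 and [odd_components M] elements. *)
    split=> //; apply/esym/card_eq_II.
    by apply: card_eq_trans (reflections_cc2 refl); rewrite card_eq_sym.
  rewrite -Mconn; apply: reflections_cc2; exact/reflections_iff.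
move=> /reflections_iff refl; split; first exact: reflections_cc2.
exact: max_card.
Qed.
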